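(* Let $(X,\|\cdot\|)$ be a superreflexive (real) Banach space, let $E\subset X$ be a nonempty compact set, let $f:E\to\mathbb{R}$ be a function and let $G:E\to X^*$ be continuous. Then there exists a convex function $F\in C^1(X)$ with $F=f$ and $DF=G$ on $E$ if and only if both of the following conditions hold: (C) $f(y)\ge f(z)+G(z)(y-z)$ for all $y,z\in E$; (CW$^1$) for all $y,z\in E$, if $f(y)=f(z)+G(z)(y-z)$ then $G(y)=G(z)$. Moreover, in that case $F$ can be taken to be Lipschitz on $X$, with $$\operatorname{Lip}(F,X)=\sup_{x\in X}\|DF(x)\|_*=\sup_{z\in E}\|G(z)\|_*.$$
   Context: $X^*$ is the dual of $X$ with dual norm $\|\cdot\|_*$. $C^1(X)$ is the class of functions $F:X\to\mathbb{R}$ that are everywhere Fréchet differentiable with continuous Fréchet derivative $DF:X\to X^*$. $\operatorname{Lip}(F,X)=\sup_{x\ne z}\frac{|F(x)-F(z)|}{\|x-z\|}$. *)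

(* Defs.v *)
From HB Require Import structures.
From mathcomp Require Import all_boot all_order all_algebra.
From mathcomp Require Import all_classical all_reals all_analysis.

Set Implicit Arguments.
Unset Strict Implicit.
Unset Printing Implicit Defensive.

Import Order.TTheory GRing.Theory Num.Theory.
Import numFieldNormedType.Exports.

Local Open Scope classical_set_scope.
Local Open Scope ring_scope.

Section Dual.
Context {R : realType}.

Definition dual_pred (X : normedModType R) : {pred X -> R^o} :=
  mem [set phi : X -> R^o | linear phi /\ continuous phi].

Record dual (X : normedModType R) : Type := Dual {
  dual_fun :> X -> R^o;
  dual_funP : dual_fun \in @dual_pred X }.

Section Instances.
Context {X : normedModType R}.
Implicit Types (phi psi : dual X) (x y : X).

HB.instance Definition _ := [isSub for @dual_fun X].
HB.instance Definition _ := [Choice of dual X by <:].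

Lemma dual_submod_closed : submod_closed (@dual_pred X).
Proof.
split.
  by rewrite inE; split=> [a x y|x]; [rewrite scaler0 addr0|exact: cvg_cst].
move=> a phi psi; rewrite !inE => -[lphi cphi] [lpsi cpsi]; split.
  move=> b x y; rewrite !fctE lphi lpsi; rewrite !scalerDr !scalerA (mulrC a b).
  by rewrite -!addrA; congr (_ + _); rewrite addrCA.
move=> x; apply: continuousD; last exact: cpsi.
by apply: continuousZl_tmp; exact: cphi.
Qed.

HB.instance Definition _ :=
  GRing.isSubmodClosed.Build _ _ (@dual_pred X) dual_submod_closed.
HB.instance Definition _ := [SubChoice_isSubLmodule of dual X by <:].

Lemma dualP phi : linear phi /\ continuous phi.
Proof. by have := dual_funP phi; rewrite inE. Qed.

Lemma dual_ext phi psi : (forall x, phi x = psi x) -> phi = psi.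
Proof. by move=> h; apply/val_inj/funext. Qed.

Lemma dualD phi psi x : (phi + psi) x = phi x + psi x.
Proof. by []. Qed.

Lemma dualB phi psi x : (phi - psi) x = phi x - psi x.
Proof. by []. Qed.

Lemma dualZ (a : R) phi x : (a *: phi) x = a * phi x.
Proof. by []. Qed.

Lemma dual0 x : (0 : dual X) x = 0.
Proof. by []. Qed.

Lemma dual_fun0 phi : phi 0 = 0.
Proof.
have [+ _] := dualP phi => /(_ (-1) 0 0).
by rewrite scaler0 addr0 scaleN1r addNr.
Qed.

Lemma dual_funZ phi (a : R) x : phi (a *: x) = a * phi x.
Proof.
have [+ _] := dualP phi => /(_ a x 0).
by rewrite addr0 dual_fun0 addr0.
Qed.

Definition dual_norm phi : R := sup [set `|phi x| | x in [set x | `|x| <= 1]].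

Lemma dual_norm_has_sup phi :
  has_sup [set `|phi x| | x in [set x | `|x| <= 1]].
Proof.
split; first by exists `|phi 0|, 0 => //=; rewrite normr0.
have [_ /(_ 0)/cvgrPdist_lt /(_ 1 ltr01)] := dualP phi.
rewrite dual_fun0 => /nbhs_ballP[e /= e0 eb].
exists (2 / e) => _ [x /= x1 <-].
have e2 : 0 < e / 2 by rewrite divr_gt0.
have /eb : ball 0 e ((e / 2) *: x).
  rewrite -ball_normE /= sub0r normrN normrZ gtr0_norm//.
  apply: (@le_lt_trans _ _ (e / 2)); first by rewrite ler_piMr// ltW.
  by rewrite ltr_pdivrMr// ltr_pMr// ltr1n.
rewrite /= sub0r normrN dual_funZ normrM gtr0_norm// -ltr_pdivlMl//.
by rewrite mulr1 invf_div => /ltW.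
Qed.

Lemma dual_norm_le phi x : `|x| <= 1 -> `|phi x| <= dual_norm phi.
Proof.
by move=> x1; apply: (sup_upper_bound (dual_norm_has_sup phi)); exists x.
Qed.

Lemma dual_norm_le_ub phi (M : R) :
  (forall x, `|x| <= 1 -> `|phi x| <= M) -> dual_norm phi <= M.
Proof.
move=> h; apply: ge_sup; first by have [] := dual_norm_has_sup phi.
by move=> _ [x /= x1 <-]; exact: h.
Qed.

Lemma dual_normD phi psi :
  dual_norm (phi + psi) <= dual_norm phi + dual_norm psi.
Proof.
apply: dual_norm_le_ub => x x1; rewrite dualD (le_trans (ler_normD _ _))//.
by rewrite lerD// dual_norm_le.
Qed.

Lemma dual_normZ (a : R) phi : dual_norm (a *: phi) = `|a| * dual_norm phi.
Proof.
have le b psi : dual_norm (b *: psi) <= `|b| * dual_norm psi.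
  by apply: dual_norm_le_ub => x x1; rewrite dualZ normrM ler_wpM2l// dual_norm_le.
apply/eqP; rewrite eq_le le /=.
have [->|a0] := eqVneq a 0.
  rewrite normr0 mul0r (le_trans _ (@dual_norm_le _ 0 _))// normr0//.
by rewrite -ler_pdivlMl ?normr_gt0// -normfV -{1}[phi](scalerK a0).
Qed.

Lemma dual_norm_eq0 phi : dual_norm phi = 0 -> phi = 0.
Proof.
move=> phi0; apply: dual_ext => x; rewrite dual0.
have [->|x0] := eqVneq x 0; first exact: dual_fun0.
have := @dual_norm_le phi (`|x|^-1 *: x).
rewrite normrZ normfV normr_id mulVf ?normr_eq0// => /(_ (lexx _)).
by rewrite phi0 normr_le0 dual_funZ mulf_eq0 invr_eq0 normr_eq0 (negbTE x0) => /eqP.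
Qed.

HB.instance Definition _ :=
  Lmodule_isNormed.Build R (dual X) dual_normD dual_normZ dual_norm_eq0.

Lemma dual_normE phi : `|phi| = dual_norm phi.
Proof. by []. Qed.

End Instances.

(* The canonical embedding of [Y] into its bidual is onto. *)
Definition reflexive_space (Y : normedModType R) : Prop :=
  forall Phi : dual (dual Y), exists y : Y, forall phi : dual Y, Phi phi = phi y.

Definition lin_span (Y : normedModType R) n (y : 'I_n -> Y) : set Y :=
  [set \sum_i a i *: y i | a in [set: 'I_n -> R]].

(* James: every finite-dimensional subspace of [Y] is (1 + e)-isomorphic to a
   subspace of [X].  The linear map of the definition lives on the subspace;
   asking for one defined on all of [Y] (not necessarily continuous) is no
   restriction, since linear maps extend along a complement. *)
Definition finitely_representable (Y X : normedModType R) : Prop :=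
  forall (e : R) n (y : 'I_n -> Y), 0 < e ->
    exists T : {linear Y -> X}, forall v, lin_span y v ->
      `|v| <= `|T v| /\ `|T v| <= (1 + e) * `|v|.

Definition superreflexive (X : normedModType R) : Prop :=
  forall Y : completeNormedModType R,
    finitely_representable Y X -> reflexive_space Y.

(* [DF F x] is the Frechet derivative of [F] at [x] as an element of the dual;
   it is the junk value [0] when [F] is not differentiable at [x]. *)
Definition DF (X : normedModType R) (F : X -> R^o) (x : X) : dual X :=
  insubd (0 : dual X) ('d F x : X -> R^o).

Lemma DFE (X : normedModType R) (F : X -> R^o) (x : X) :
  differentiable F x -> DF F x = 'd F x :> (X -> R^o).
Proof.
move=> dF; rewrite /DF; apply: (@insubdK _ _ (dual X)); rewrite inE; split.
  by move=> a u v; rewrite linearP.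
exact: diff_continuous.
Qed.

Definition C1 (X : normedModType R) (F : X -> R^o) : Prop :=
  (forall x, differentiable F x) /\ continuous (DF F).

(* The supremum is taken in [0, +oo], so that it is [0] when [X] is trivial. *)
Definition Lip (X : normedModType R) (F : X -> R^o) : \bar R :=
  ereal_sup (0%E |`
    [set (`|F p.1 - F p.2| / `|p.1 - p.2|)%:E
       | p in [set p : X * X | p.1 != p.2]]).

End Dual.

(* Main.v *)
(* Let [C] be the set of functionals lying below [sup_(z in E) G z] pointwise, a
   norm-compact convex set.  For a convex continuous [psi] on [C], the conjugate
   [F x = max_(phi in C) (phi x - psi phi)] interpolates [(f, G)] on [E] as soon
   as [psi phi >= phi z - f z] for all [z] in [E], with equality at [G z]; and [F]
   is [C^1] with gradient in [C] when [psi] is strictly convex, because the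
   maximizer is then unique and, by compactness of [C], norm continuous in [x].
   Such functions [psi] exist: [g phi = max_(z in E) (phi z - f z)] is admissible by
   (C), and it remains so when one takes its maximum with [phi (z + e x) - f z - e k],
   where (CW^1) leaves room for the kink of this maximum to lie strictly inside
   a given segment.  By compactness, countably many of these functions break every
   segment of [C], and their dyadic mean is strictly convex. *)
Require Import Defs.
From HB Require Import structures.
From mathcomp Require Import all_boot all_order all_algebra.
From mathcomp Require Import all_classical all_reals all_analysis.
From mathcomp Require Import ring lra.

Set Implicit Arguments.
Unset Strict Implicit.
Unset Printing Implicit Defensive.

Import Order.TTheory GRing.Theory Num.Theory.
Import numFieldNormedType.Exports.

Local Open Scope classical_set_scope.
Local Open Scope ring_scope.

(** * Functionals below the support function of a compact set *)

Lemma ultra_fmap_cvg (S : Type) (T : topologicalType) (U : set_system S)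
    (h : S -> T) (A : set T) :
  UltraFilter U -> compact A -> U (h @^-1` A) -> exists l : T, h @ U --> l.
Proof.
move=> UU cA UA.
have [l [_ hl]] := cA (h @ U) _ UA.
exists l => B lB.
have [//|UnB] := in_ultra_setVsetC (h @^-1` B) UU.
by have [? []] := hl (~` B) B UnB lB.
Qed.

Lemma near_dist_lt (R : realType) (Y : normedModType R) (y : Y) (e : R) :
  0 < e -> \forall z \near y, `|y - z| < e.
Proof. by move=> e0; apply: cvgr_dist_lt. Qed.

Lemma compact_norm_bound (R : realType) (Y : normedModType R) (K : set Y) :
  compact K -> exists2 M : R, 0 <= M & forall y, K y -> `|y| <= M.
Proof.
move=> cK; have [M [_ KM]] := compact_bounded cK.
exists (`|M| + 1); first by rewrite addr_ge0.
by apply: KM; rewrite (le_lt_trans (ler_norm _))// ltrDl.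
Qed.

Lemma ler_dual (R : realType) (X : normedModType R) (phi : dual X) (x : X) :
  `|phi x| <= `|phi| * `|x|.
Proof.
have [->|x0] := eqVneq x 0; first by rewrite dual_fun0 !normr0 mulr0.
have x1 : `| `|x|^-1 *: x| <= 1.
  by rewrite normrZ normfV normr_id mulVf// normr_eq0.
have := @dual_norm_le R X phi _ x1; rewrite dual_funZ normrM normfV normr_id.
by rewrite -dual_normE ler_pdivrMl ?normr_gt0// mulrC.
Qed.

Lemma dual_norming (R : realType) (X : normedModType R) (phi : dual X) (c : R) :
  c < `|phi| -> exists2 x, `|x| <= 1 & c < `|phi x|.
Proof.
move=> cphi; have phic : 0 < `|phi| - c by rewrite subr_gt0.
have [_ [x /= x1 <-]] := sup_adherent phic (@dual_norm_has_sup R X phi).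
by rewrite -/(dual_norm phi) -dual_normE subKr => h; exists x.
Qed.

Lemma dual_funD (R : realType) (X : normedModType R) (phi : dual X) (x y : X) :
  phi (x + y) = phi x + phi y.
Proof. by have [+ _] := dualP phi => /(_ 1 x y); rewrite !scale1r. Qed.

Lemma dual_funN (R : realType) (X : normedModType R) (phi : dual X) (x : X) :
  phi (- x) = - phi x.
Proof. by rewrite -scaleN1r dual_funZ mulN1r. Qed.

Lemma dual_funB (R : realType) (X : normedModType R) (phi : dual X) (x y : X) :
  phi (x - y) = phi x - phi y.
Proof. by rewrite dual_funD dual_funN. Qed.

Lemma dual_norm_le_lipschitz (R : realType) (X : normedModType R) (phi : dual X)
  (M : R) : 0 <= M -> (forall x, `|phi x| <= M * `|x|) -> `|phi| <= M.
Proof.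
move=> M0 h; apply: dual_norm_le_ub => x x1.
by rewrite (le_trans (h x))// ler_piMr.
Qed.

Lemma lip_continuous (R : realType) (Y Z : normedModType R) (h : Y -> Z) (M : R) :
  (forall x y, `|h x - h y| <= M * `|x - y|) -> continuous h.
Proof.
move=> hM x; apply/cvgrPdist_lt => e e0.
have M1 : 0 < `|M| + 1 by rewrite ltr_wpDl.
near=> y; rewrite (le_lt_trans (hM _ _))//.
rewrite (@le_lt_trans _ _ ((`|M| + 1) * `|x - y|))//.
  by rewrite ler_wpM2r// (le_trans (ler_norm _))// lerDl.
rewrite -ltr_pdivlMl//; near: y; apply: near_dist_lt.
by rewrite mulr_gt0// invr_gt0.
Unshelve. all: by end_near. Qed.

Lemma dual_of_bounded (R : realType) (X : normedModType R) (l : X -> R) (M : R) :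
  (forall a x y, l (a *: x + y) = a * l x + l y) ->
  (forall x, `|l x| <= M * `|x|) -> exists phi : dual X, forall x, phi x = l x.
Proof.
move=> ladd lM.
have lP : (l : X -> R^o) \in @dual_pred R X.
  rewrite inE; split; first exact: ladd.
  apply: (@lip_continuous _ X R^o l M) => x y.
  by rewrite -[l x - l y]addrC -mulN1r -ladd scaleN1r addrC.
by exists (Dual lP).
Qed.

Lemma dual_eval_continuous (R : realType) (X : normedModType R) (x : X) :
  continuous (fun phi : dual X => phi x : R).
Proof.
apply: (@lip_continuous _ (dual X) R^o _ `|x|) => phi psi.
by rewrite -dualB mulrC ler_dual.
Qed.

(** The weak-* closed convex hull of [K], encoded by its support function, so that membership passes
    to pointwise limits and bounds valid on [K] pass to [phi]. *)
Definition below_support (R : realType) (X : normedModType R)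
    (K : set (dual X)) : set (dual X) :=
  [set phi | forall x m, (forall k, K k -> k x <= m) -> phi x <= m].

Lemma below_support_norm_le (R : realType) (X : normedModType R)
    (K : set (dual X)) (phi : dual X) (x : X) (m : R) :
  below_support K phi -> (forall k, K k -> `|k x| <= m) -> `|phi x| <= m.
Proof.
move=> Kphi h; rewrite ler_norml lerNl -dual_funN.
by rewrite !Kphi// => k /h; rewrite ?dual_funN ler_norml => /andP[]; lra.
Qed.

Lemma norm_below_support_le (R : realType) (X : normedModType R)
    (K : set (dual X)) (M : R) : 0 <= M -> (forall k, K k -> `|k| <= M) ->
  forall phi, below_support K phi -> `|phi| <= M.
Proof.
move=> M0 KM phi Kphi; apply: dual_norm_le_lipschitz => // x.
apply: (below_support_norm_le (K := K)) => // k Kk.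
by rewrite (le_trans (ler_dual _ _))// ler_wpM2r// KM.
Qed.

(** An ultrafilter on this set has a pointwise limit [phi0] in it, by boundedness. If it stayed away
    from [phi0] in norm, the vectors norming the differences would vary along it; compactness of [K]
    allows them to be frozen at one vector [x'], where pointwise convergence is contradicted. *)
Lemma compact_below_support (R : realType) (X : normedModType R)
  (K : set (dual X)) : compact K -> compact (below_support K).
Proof.
move=> cK; rewrite compact_ultra => U UU UC; set C := below_support K in UC *.
have [M M0 KM] := compact_norm_bound cK.
have CM := norm_below_support_le M0 KM.
have ptM (phi : dual X) x : C phi -> `|phi x| <= M * `|x|.
  by move=> /CM ?; rewrite (le_trans (ler_dual _ _))// ler_wpM2r.
have segP (phi : dual X) x (r : R) : `|phi x| <= r ->
    [set` `[- r, r]] (phi x) by rewrite /= in_itv/= ler_norml.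
have /choice[l Ul] x : exists lx : R, (fun phi : dual X => phi x : R) @ U --> lx.
  apply: (@ultra_fmap_cvg _ _ _ _ _ UU (@segment_compact R (- (M * `|x|)) (M * `|x|))).
  by apply: filterS UC => phi Cphi; apply/segP/ptM.
have llin a x y : l (a *: x + y) = a * l x + l y.
  apply: (cvg_unique (@Rhausdorff R) (Ul (a *: x + y))).
  rewrite /= (_ : (fun phi : dual X => _) = fun phi => a * phi x + phi y).
    by apply: cvgD; [apply: cvgMr|]; exact: Ul.
  by apply/funext => phi; rewrite dual_funD dual_funZ.
have lC x m : (forall k, K k -> k x <= m) -> l x <= m.
  move=> h; apply: (cvgr_to_le (Ul x)) => //.
  by apply: filterS UC => phi /(_ _ _ h).
have [phi0 lE] : exists phi : dual X, forall x, phi x = l x.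
  apply: (@dual_of_bounded _ _ l M) => // x.
  have lb y : l y <= M * `|y|.
    apply: lC => k /KM kM; rewrite (le_trans (ler_norm _))//.
    by rewrite (le_trans (ler_dual _ _))// ler_wpM2r.
  rewrite ler_norml lb andbT lerNl.
  have := llin (-1) x 0; rewrite addr0 mulN1r.
  have := llin 1 0 0; rewrite scale1r addr0 mul1r => l0.
  rewrite (_ : l 0 = 0) ?addr0 => [<-|]; last lra.
  by rewrite scaleN1r (le_trans (lb _))// normrN.
have Cphi0 : C phi0 by move=> x m /lC; rewrite lE.
exists phi0; split=> //=; apply/cvgrPdist_lt => e e0.
have [//|Ufar] := in_ultra_setVsetC [set phi | `|phi0 - phi| < e] UU.
(* [xs phi] detects at least half of the distance from a far [phi] to [phi0]. *)
have /choice[xs xsP] (phi : dual X) : exists x : X, `|x| <= 1 /\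
    (e <= `|phi0 - phi| -> e / 2 < `|phi0 x - phi x|).
  have [efar|] := leP e `|phi0 - phi|; last by exists 0; rewrite normr0.
  have [|x x1 ex] := @dual_norming _ _ (phi0 - phi) (e / 2).
    by rewrite (lt_le_trans _ efar)// ltr_pdivrMr// ltr_pMr// ltr1n.
  by exists x.
have /choice[L UL] (k : dual X) : exists Lk : R, (fun phi => k (xs phi) : R) @ U --> Lk.
  apply: (@ultra_fmap_cvg _ _ _ _ _ UU (@segment_compact R (- `|k|) (`|k|))).
  apply: filterS (@filterT _ U _) => phi _; apply: segP.
  by rewrite (le_trans (ler_dual _ _))// ler_piMr// (xsP phi).1.
(* Three errors of size [d] will add up to [e / 2]. *)
pose d := e / 6; have d0 : 0 < d by rewrite divr_gt0.
(* Compactness of [K] makes [k (xs phi)] Cauchy along [U] uniformly in [k]. *)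
have [[A B] /= [UA UB] AB] : \forall p \near filter_prod U U,
    K `<=` (fun k => `|k (xs p.1 - xs p.2)| < d).
  have /compact_near_coveringP := cK; apply=> k0 Kk0.
  have Uk0 : \forall phi \near U, `|L k0 - k0 (xs phi)| < d / 6.
    by apply: (@cvgr_dist_lt _ _ _ _ _ _ _ (UL k0)); rewrite divr_gt0.
  near=> k p => /=.
  have p1 : `|L k0 - k0 (xs p.1)| < d / 6 by near: p; exact: (cvg_fst Uk0).
  have p2 : `|L k0 - k0 (xs p.2)| < d / 6 by near: p; exact: (cvg_snd Uk0).
  have kk : `|k0 - k| < d / 6.
    by near: k; apply: near_dist_lt; rewrite divr_gt0.
  have kx (phi : dual X) : `|k0 (xs phi) - k (xs phi)| < d / 6.
    rewrite -dualB (le_lt_trans (ler_dual _ _))// (le_lt_trans _ kk)//.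
    by rewrite ler_piMr// (xsP phi).1.
  have := kx p.1; have := kx p.2; move: p1 p2; rewrite dual_funB.
  rewrite !ltr_norml => /andP[? ?] /andP[? ?] /andP[? ?] /andP[? ?].
  by apply/andP; lra.
have [psi Bpsi] := filter_ex UB; set x' := xs psi.
have Ux' : U [set phi : dual X | `|l x' - phi x'| < d].
  by apply: (@cvgr_dist_lt _ _ _ _ _ _ _ (Ul x')).
have [phi [[[Aphi Cphi] /= far] clo]] := filter_ex (filterI (filterI (filterI UA UC) Ufar) Ux').
have := (xsP phi).2; rewrite leNgt => /(_ (introN idP far)).
(* The Cauchy bound on [K] passes to the hull: replacing [xs phi] by [x'] costs at most [d] under
   both [phi] and [phi0]. *)
have near_x' (chi : dual X) : C chi -> `|chi (xs phi) - chi x'| <= d.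
  move=> Cchi; rewrite -dual_funB.
  apply: (below_support_norm_le (K := K)) => // k Kk.
  by apply/ltW/(AB (phi, psi)).
have := near_x' _ Cphi; have := near_x' _ Cphi0; move: clo; rewrite /= -lE.
have -> : e / 2 = 3 * d by rewrite /d; lra.
rewrite lter_norml !ler_norml => /andP[? ?] /andP[? ?] /andP[? ?].
rewrite ltNge ler_norml => /negP[]; apply/andP; lra.
Unshelve. all: by end_near. Qed.

(** * Conjugates of strictly convex functions *)

Lemma near_continuous_dist_lt (R : realType) (Y : normedModType R) (h : Y -> R)
    (y : Y) (e : R) :
  continuous h -> 0 < e -> \forall z \near y, `|h y - h z| < e.
Proof. by move=> ch e0; apply: (@cvgr_dist_lt _ R^o _ _ _ _ _ (ch y)). Qed.

Lemma diff_of_estimate (R : realType) (X : normedModType R) (F : X -> R^o)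
    (x : X) (phi : dual X) :
  (forall e : R, 0 < e -> \forall h \near (0 : X),
    `|F (h + x) - F x - phi h| <= e * `|h|) ->
  differentiable F x /\ DF F x = phi.
Proof.
move=> hF; have [phil phic] := dualP phi.
pose L : {linear X -> R^o} :=
  HB.pack (phi : X -> R^o) (GRing.isLinear.Build _ _ _ _ _ phil).
have FL : F \o shift x = cst (F x) + L +o_ (0 : X) id.
  apply/eqaddoP => e e0; near=> h.
  rewrite [X in `|X|](_ : _ = F (h + x) - F x - phi h); last first.
    by rewrite /= opprD addrA.
  by near: h; exact: hF.
have dL := @diff_unique _ _ _ F L x phic FL.
have dF : differentiable F x by apply/diff_locallyP; rewrite dL.
by split=> //; apply: dual_ext => y; rewrite DFE// dL.
Unshelve. all: by end_near. Qed.

(** The subgradient inequalities at [x] and at [h + x] squeeze [F (h + x) - F x - A x h] between 0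
    and [(A (h + x) - A x) h], which is o(h) by continuity of [A]. *)
Lemma diff_of_subgradient (R : realType) (X : normedModType R) (F : X -> R^o)
    (A : X -> dual X) (x : X) :
  (forall y z, A y (z - y) <= F z - F y) -> {for x, continuous A} ->
  differentiable F x /\ DF F x = A x.
Proof.
move=> sub cA; apply: diff_of_estimate => e e0.
have nA : \forall h \near (0 : X), `|A x - A (h + x)| < e.
  rewrite (near_shift x); apply: filterS (@cvgr_dist_lt _ _ _ _ _ _ _ cA e e0) => y.
  by rewrite /= sub0r subrK.
near=> h.
have h1 : A x h <= F (h + x) - F x by have := sub x (h + x); rewrite addrK.
have h2 : F (h + x) - F x <= A (h + x) h.
  have := sub (h + x) x; rewrite opprD addrCA subrr addr0 dual_funN.
  by rewrite lerNl opprB.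
rewrite ger0_norm ?subr_ge0//.
apply: (@le_trans _ _ (A (h + x) h - A x h)); first by rewrite lerB.
rewrite -dualB (le_trans (ler_norm _))// (le_trans (ler_dual _ _))//.
rewrite ler_wpM2r// distrC ltW//; near: h; exact: nA.
Unshelve. all: by end_near. Qed.

(* A unique maximizer of [phi x - psi phi] over a compact [C] is a continuous
   selection of the subdifferential of the conjugate of [psi] on [C]. *)
Lemma conjugate_C1 (R : realType) (X : normedModType R) (C : set (dual X))
    (psi : dual X -> R) (M : R) :
  compact C -> C !=set0 -> continuous psi ->
  (forall phi, C phi -> `|phi| <= M) ->
  (forall x phi1 phi2, C phi1 -> C phi2 ->
    (forall phi, C phi -> phi x - psi phi <= phi1 x - psi phi1) ->
    (forall phi, C phi -> phi x - psi phi <= phi2 x - psi phi2) ->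
    phi1 = phi2) ->
  exists F : X -> R,
    [/\ convex_function (setT : set (convex_lmodType X)) F, C1 F,
      forall x y, `|F x - F y| <= M * `|x - y| &
      forall x, [/\ C (DF F x), F x = DF F x x - psi (DF F x) &
        forall phi, C phi -> phi x - psi phi <= F x] ].
Proof.
move=> cC C0 cpsi CM uniq.
have /choice[A Amax] x : exists phi, C phi /\
    forall chi, C chi -> chi x - psi chi <= phi x - psi phi.
  have [|phi] := compact_EVT_max C0 cC (f := fun phi : dual X => phi x - psi phi).
    apply: continuous_subspaceT => phi.
    exact: (@cvgB _ R^o _ _ _ _ _ _ _ (@dual_eval_continuous _ _ x phi) (cpsi phi)).
  by rewrite inE => Cphi h; exists phi; split=> // chi Cchi; apply: h; rewrite inE.
pose F x := A x x - psi (A x).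
have CA x : C (A x) by have [] := Amax x.
have Fge x phi : C phi -> phi x - psi phi <= F x by have [_] := Amax x; exact.
have sub y z : A y (z - y) <= F z - F y.
  by have := Fge z _ (CA y); rewrite /F dual_funB; lra.
have AM x y : `|A x y| <= M * `|y|.
  by rewrite (le_trans (ler_dual _ _))// ler_wpM2r// CM.
have FM x y : `|F x - F y| <= M * `|x - y|.
  have := sub x y; have := sub y x; have := AM x (x - y); have := AM y (x - y).
  rewrite -(opprB x y) dual_funN !ler_norml => /andP[? ?] /andP[? ?] ? ?.
  by apply/andP; lra.
have cA x : {for x, continuous A}.
  suff nA e : 0 < e -> \forall y \near x, `|A x - A y| < e.
    apply/(@cvg_ballP _ (dual X)) => e e0; near=> y.
    by rewrite -ball_normE /=; near: y; exact: nA.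
  move=> e0.
  (* For [y] near [x], every [phi] in [C] is close to [A x] or fails to be a maximizer at [y]; the
     maximizer [A y] must then be close. *)
  have : \forall y \near x, C `<=`
      (fun phi => C phi -> `|A x - phi| < e \/ phi y - psi phi < F y).
    have /compact_near_coveringP := cC; apply=> phi0 Cphi0.
    have [clo|far] := ltP `|A x - phi0| e.
      near=> phi y => _; left.
      have phi0phi : `|phi0 - phi| < e - `|A x - phi0|.
        by near: phi; apply: near_dist_lt; rewrite subr_gt0.
      by rewrite (le_lt_trans (ler_distD phi0 _ _))// -ltrBrDl.
    (* By uniqueness a far [phi0] misses the maximum by a positive gap; each of the four
       perturbations below uses at most a quarter of it. *)
    have d0 : 0 < F x - (phi0 x - psi phi0).
      rewrite subr_gt0 lt_neqAle Fge// andbT; apply/eqP => eqF.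
      suff E : A x = phi0 by move: far; rewrite E subrr normr0 leNgt e0.
      by apply: (uniq x) => // chi Cchi; rewrite ?eqF; exact: Fge.
    set d := F x - _ in d0.
    have M1 : 0 < `|M| + 1 by rewrite ltr_wpDl.
    near=> phi y => Cphi; right.
    have p1 : `|phi0 x - phi x| < d / 4.
      near: phi; apply: (near_continuous_dist_lt _ (@dual_eval_continuous _ _ x)).
      by rewrite divr_gt0.
    have p2 : `|psi phi0 - psi phi| < d / 4.
      by near: phi; apply: (near_continuous_dist_lt _ cpsi); rewrite divr_gt0.
    have xy : M * `|x - y| <= d / 4.
      rewrite (@le_trans _ _ ((`|M| + 1) * `|x - y|))//.
        by rewrite ler_wpM2r// (le_trans (ler_norm _))// lerDl.
      rewrite -ler_pdivlMl// ltW//; near: y; apply: near_dist_lt.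
      by rewrite mulr_gt0 ?divr_gt0// invr_gt0.
    have p3 : `|phi x - phi y| <= d / 4.
      rewrite -dual_funB (le_trans (ler_dual _ _))// (le_trans _ xy)//.
      by rewrite ler_wpM2r// CM.
    have p4 := le_trans (FM x y) xy.
    have dE : d = F x - (phi0 x - psi phi0) by [].
    move: p1 p2 p3 p4; rewrite !ltr_norml !ler_norml.
    by move=> /andP[? ?] /andP[? ?] /andP[? ?] /andP[? ?]; lra.
  apply: filterS => y /(_ _ (CA y) (CA y))[//|].
  by rewrite /F ltxx.
have dF x : differentiable (F : X -> R^o) x /\ DF F x = A x.
  exact: diff_of_subgradient.
exists F; split=> //.
- move=> t x y _ _; set w := conv t x y.
  have wE : w = t%:num *: (x : X) + (1 - t%:num) *: (y : X) by [].
  have t0 : 0 <= t%:num by [].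
  have t1 : 0 <= 1 - t%:num by rewrite subr_ge0.
  have hx := ler_wpM2l t0 (sub w x); have hy := ler_wpM2l t1 (sub w y).
  (* The linear terms of the two subgradient inequalities at [w] cancel. *)
  have w0 : t%:num * A w (x - w) + (1 - t%:num) * A w (y - w) = 0.
    rewrite -!dual_funZ -dual_funD !scalerBr addrACA -opprD -scalerDl.
    by rewrite -wE subrKC scale1r subrr dual_fun0.
  rewrite [leRHS](_ : _ = t%:num * F x + (1 - t%:num) * F y)//.
  by move: hx hy w0; lra.
- split=> [x|x]; first by have [] := dF x.
  by rewrite (_ : DF _ = A); [exact: cA|apply/funext => y; have [] := dF y].
- by move=> x; have [_ ->] := dF x; split=> // phi; exact: Fge.
Unshelve. all: by end_near. Qed.

(** * Dyadic means *)

(** A convex combination: the weights are positive and sum to 1. It is meaningful for bounded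
    sequences. *)
Definition dyadic_mean (R : realType) (a : nat -> R) : R :=
  limn (series (fun k => a k / (2 ^ (k + 1))%:R)).

Lemma is_cvg_dyadic (R : realType) (a : nat -> R) (B : R) :
  (forall n, `|a n| <= B) -> cvgn (series (fun k => a k / (2 ^ (k + 1))%:R : R)).
Proof.
move=> aB; apply: normed_cvg.
apply: (@series_le_cvg _ _ (fun k => B / (2 ^ (k + 1))%:R)) => [n|n|n|].
- exact: normr_ge0.
- by rewrite divr_ge0// (le_trans _ (aB n)).
- by rewrite /= normrM normfV (ger0_norm (ler0n _ _)) ler_wpM2r// invr_ge0.
- exact: cvgP (@cvg_geometric_series_half R B 0%N).
Qed.

Lemma dyadic_mean_cst (R : realType) (c : R) : dyadic_mean (fun=> c) = c.
Proof.
apply/cvg_lim; first exact: Rhausdorff.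
by have := @cvg_geometric_series_half R c 0%N; rewrite expr0 divr1.
Qed.

Lemma dyadic_mean_linear (R : realType) (s t : R) (a b : nat -> R) (A B : R) :
  (forall n, `|a n| <= A) -> (forall n, `|b n| <= B) ->
  dyadic_mean (fun n => s * a n + t * b n) = s * dyadic_mean a + t * dyadic_mean b.
Proof.
move=> /is_cvg_dyadic ca /is_cvg_dyadic cb; apply/cvg_lim; first exact: Rhausdorff.
rewrite (_ : series _ = fun n => s * series (fun k => a k / (2 ^ (k + 1))%:R) n
                               + t * series (fun k => b k / (2 ^ (k + 1))%:R) n).
  by apply: cvgD; apply: cvgMr.
apply/funext => n; rewrite /series/= !mulr_sumr -big_split/=.
by apply: eq_bigr => k _; rewrite mulrDl !mulrA.
Qed.

(** Applied to differences [b - a], this gives both monotonicity and strict monotonicity of the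
    mean. *)
Lemma dyadic_mean_ge0 (R : realType) (a : nat -> R) (A : R) :
  (forall n, `|a n| <= A) -> (forall n, 0 <= a n) ->
  forall n, a n / (2 ^ (n + 1))%:R <= dyadic_mean a.
Proof.
move=> /is_cvg_dyadic ca a0 n.
have w0 k : 0 <= a k / (2 ^ (k + 1))%:R by rewrite divr_ge0.
apply: (@le_trans _ _ (series (fun k => a k / (2 ^ (k + 1))%:R) n.+1)).
  by rewrite /series/= big_nat_recr//= lerDr sumr_ge0.
apply: nondecreasing_cvgn_le => //.
by apply: nondecreasing_series => k _ _; exact: w0.
Qed.

Lemma dyadic_mean_le (R : realType) (a b : nat -> R) (A B : R) :
  (forall n, `|a n| <= A) -> (forall n, `|b n| <= B) ->
  (forall n, a n <= b n) -> dyadic_mean a <= dyadic_mean b.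
Proof.
move=> aA bB ab; have := dyadic_mean_linear 1 (-1) bB aA.
rewrite mul1r mulN1r => /esym E; rewrite -subr_ge0 E.
have d0 n : 0 <= 1 * b n + -1 * a n by rewrite mul1r mulN1r subr_ge0.
have dAB n : `|1 * b n + -1 * a n| <= B + A.
  by rewrite mul1r mulN1r (le_trans (ler_normB _ _))// lerD.
by apply: le_trans (dyadic_mean_ge0 dAB d0 0%N); rewrite divr_ge0.
Qed.

Lemma dyadic_mean_lt (R : realType) (a b : nat -> R) (A B : R) (n : nat) :
  (forall k, `|a k| <= A) -> (forall k, `|b k| <= B) ->
  (forall k, a k <= b k) -> a n < b n -> dyadic_mean a < dyadic_mean b.
Proof.
move=> aA bB ab abn; have := dyadic_mean_linear 1 (-1) bB aA.
rewrite mul1r mulN1r => /esym E; rewrite -subr_gt0 E.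
have d0 k : 0 <= 1 * b k + -1 * a k by rewrite mul1r mulN1r subr_ge0.
have dAB k : `|1 * b k + -1 * a k| <= B + A.
  by rewrite mul1r mulN1r (le_trans (ler_normB _ _))// lerD.
apply: lt_le_trans (dyadic_mean_ge0 dAB d0 n).
by rewrite mul1r mulN1r divr_gt0 ?subr_gt0// ltr0n expn_gt0.
Qed.

(** Supplies the continuity required by the extreme value theorem on [E], where [G] is continuous
    only relative to [E]. *)
Lemma within_continuous_dominated (R : realType) (X Y : normedModType R) (E : set X)
    (G : X -> Y) (h : X -> R) (a b : R) :
  {within E, continuous G} ->
  (forall y z, E y -> E z -> `|h y - h z| <= a * `|G y - G z| + b * `|y - z|) ->
  {within E, continuous h}.
Proof.
rewrite continuous_subspace_in => hG hab; rewrite continuous_subspace_in => z zE.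
have Ez : E z by exact: set_mem.
apply/cvgrPdist_lt => e e0.
have wE (P : set X) : within E (nbhs (z : X)) P -> \forall y \near (z : subspace E), P y.
  by rewrite nbhs_subspace_in.
have nE : \forall y \near (z : subspace E), E y.
  by apply: wE; apply: withinT.
have nz d : 0 < d -> \forall y \near (z : subspace E), `|z - y| < d.
  move=> d0; apply: wE; apply: (@cvg_within _ (nbhs (z : X))).
  exact: near_dist_lt.
have nG d : 0 < d -> \forall y \near (z : subspace E), `|G z - G y| < d.
  by move=> d0; apply: (@cvgr_dist_lt _ _ _ _ _ _ _ (hG z zE)).
have a1 : 0 < `|a| + 1 by rewrite ltr_wpDl.
have b1 : 0 < `|b| + 1 by rewrite ltr_wpDl.
near=> y.
have Ey : E y by near: y.
have h1 : (`|a| + 1) * `|G z - G y| < e / 2.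
  rewrite -ltr_pdivlMl//; near: y; apply: nG.
  by rewrite mulr_gt0 ?divr_gt0// invr_gt0.
have h2 : (`|b| + 1) * `|z - y| < e / 2.
  rewrite -ltr_pdivlMl//; near: y; apply: nz.
  by rewrite mulr_gt0 ?divr_gt0// invr_gt0.
rewrite (le_lt_trans (hab _ _ Ez Ey))// (splitr e).
by apply: ltrD; [apply: le_lt_trans h1|apply: le_lt_trans h2];
  rewrite ler_wpM2r// (le_trans (ler_norm _))// lerDl.
Unshelve. all: by end_near. Qed.

(** * Strictly convex interpolants *)

Definition midpoint (R : realType) (X : normedModType R) (phi psi : dual X) : dual X :=
  2^-1 *: (phi + psi).

Lemma midpointE (R : realType) (X : normedModType R) (phi psi : dual X) (x : X) :
  midpoint phi psi x = (phi x + psi x) / 2.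
Proof. by rewrite mulrC. Qed.

(** The first two clauses give convexity. The last two make [G z] a maximizer of [phi z - u phi],
    with maximum [f z]. Sharing the constant [L] keeps countable means finite. *)
Definition interpolant (R : realType) (X : normedModType R) (E : set X) (f : X -> R)
    (G : X -> dual X) (L : R) (u : dual X -> R) : Prop :=
  [/\ forall phi psi, u (midpoint phi psi) <= (u phi + u psi) / 2,
      forall phi psi, `|u phi - u psi| <= L * `|phi - psi|,
      forall (phi : dual X) z, E z -> phi z - f z <= u phi &
      forall z, E z -> u (G z) = G z z - f z].

Definition strict_at (R : realType) (X : normedModType R) (u : dual X -> R)
    (p : dual X * dual X) : Prop :=
  u (midpoint p.1 p.2) < (u p.1 + u p.2) / 2.

Section Interpolants.
Context (R : realType) (X : normedModType R) (E : set X) (f : X -> R).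
Context (G : X -> dual X) (L : R).
Local Notation interpolant := (interpolant E f G L).

Lemma interpolant_dyadic_mean (u : nat -> dual X -> R) :
  E !=set0 -> (forall n, interpolant (u n)) ->
  let v phi := dyadic_mean (fun n => u n phi) in
  interpolant v /\ forall n p, strict_at (u n) p -> strict_at v p.
Proof.
move=> [z0 Ez0] iu v.
(* All [u n] agree at [G z0] and share the constant [L], hence a bound at [phi] uniform in [n]. *)
pose B phi := `|G z0 z0 - f z0| + L * `|phi - G z0|.
have uB phi n : `|u n phi| <= B phi.
  have [_ lu _ eu] := iu n; rewrite -(subrK (u n (G z0)) (u n phi)).
  by rewrite (le_trans (ler_normD _ _))// addrC lerD// eu.
have half phi psi : (v phi + v psi) / 2 =
    dyadic_mean (fun n => 2^-1 * u n phi + 2^-1 * u n psi).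
  rewrite (dyadic_mean_linear _ _ (uB phi) (uB psi)) /v; lra.
have halfB phi psi n : `|2^-1 * u n phi + 2^-1 * u n psi| <= B phi + B psi.
  rewrite (le_trans (ler_normD _ _))// lerD// normrM ger0_norm//;
    (rewrite (le_trans _ (uB _ n))// ler_piMl// invf_le1// ler1n//).
have um phi psi n : u n (midpoint phi psi) <= 2^-1 * u n phi + 2^-1 * u n psi.
  by have [mu _ _ _] := iu n; have := mu phi psi; lra.
have vB phi psi : v phi - v psi <= L * `|phi - psi|.
  have -> : v phi - v psi = dyadic_mean (fun n => 1 * u n phi + -1 * u n psi).
    by rewrite (dyadic_mean_linear _ _ (uB phi) (uB psi)) mul1r mulN1r.
  rewrite -[leRHS]dyadic_mean_cst.
  have dB n : `|1 * u n phi + -1 * u n psi| <= L * `|phi - psi|.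
    by rewrite mul1r mulN1r; have [_ lu _ _] := iu n; exact: lu.
  apply: (dyadic_mean_le dB) => [n|n]; first exact: lexx.
  by rewrite (le_trans (ler_norm _)).
split; first split.
- move=> phi psi; rewrite half.
  exact: (dyadic_mean_le (uB (midpoint phi psi)) (halfB phi psi)).
- by move=> phi psi; rewrite ler_norml vB andbT lerNl opprB distrC vB.
- move=> phi z Ez; rewrite -[leLHS]dyadic_mean_cst.
  apply: (dyadic_mean_le (A := `|phi z - f z|) _ (uB phi)) => n //.
  by have [_ _ gu _] := iu n; exact: gu.
- move=> z Ez; rewrite /v -[RHS]dyadic_mean_cst; congr dyadic_mean.
  by apply/funext => n; have [_ _ _ eu] := iu n; exact: eu.
move=> n [phi psi] /= un; rewrite /strict_at /= half.
apply: (dyadic_mean_lt (n := n) (uB (midpoint phi psi)) (halfB phi psi)) => //.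
by have := un; rewrite /strict_at/=; lra.
Qed.

(** The added affine function is [L]-Lipschitz because [w] has norm at most [L], and it changes no
    value at a [G y]. *)
Lemma interpolant_max (u : dual X -> R) (w : X) (c : R) :
  interpolant u -> `|w| <= L -> (forall y, E y -> G y w - c <= G y y - f y) ->
  interpolant (fun phi : dual X => Num.max (u phi) (phi w - c)).
Proof.
move=> [mu lu gu eu] wL hc; split.
- move=> phi psi; rewrite ge_max midpointE; apply/andP; split.
    by rewrite (le_trans (mu _ _))// ler_wpM2r// lerD// le_max lexx.
  rewrite (_ : _ - c = ((phi w - c) + (psi w - c)) / 2); last lra.
  by rewrite ler_wpM2r// lerD// le_max lexx orbT.
- have half (phi psi : dual X) : Num.max (u phi) (phi w - c) <=
      Num.max (u psi) (psi w - c) + L * `|phi - psi|.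
    rewrite ge_max; apply/andP; split.
      rewrite (@le_trans _ _ (u psi + L * `|phi - psi|))//.
        by have := lu phi psi; rewrite ler_norml => /andP[_]; lra.
      by rewrite lerD2r le_max lexx.
    rewrite (@le_trans _ _ (psi w - c + L * `|phi - psi|))//; last first.
      by rewrite lerD2r le_max lexx orbT.
    have : `|phi w - psi w| <= L * `|phi - psi|.
      by rewrite -dualB (le_trans (ler_dual _ _))// mulrC ler_wpM2r.
    by rewrite ler_norml => /andP[_]; lra.
  move=> phi psi; rewrite ler_norml; apply/andP; split; last first.
    by rewrite lerBlDl.
  by rewrite lerNl opprB lerBlDl distrC.
- by move=> phi z Ez; rewrite le_max gu.
- by move=> z Ez; rewrite eu//; apply/max_idPl; exact: hc.
Qed.

Lemma strict_at_open (u : dual X -> R) (p : dual X * dual X) :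
  interpolant u -> strict_at u p -> \forall q \near p, strict_at u q.
Proof.
move=> [mu lu _ _] up.
pose d := (u p.1 + u p.2) / 2 - u (midpoint p.1 p.2).
have d0 : 0 < d by rewrite subr_gt0.
have cu := @lip_continuous _ (dual X) R^o _ _ lu.
have L1 : 0 < `|L| + 1 by rewrite ltr_wpDl.
(* Within this radius [u] varies by less than a quarter of the gap [d]; the midpoint moves no more
   than the endpoints allow. *)
have small (phi : dual X) : \forall psi \near phi, `|phi - psi| < d / 4 / (`|L| + 1).
  by apply: near_dist_lt; rewrite !divr_gt0.
have n1 : \forall q \near p, `|p.1 - q.1| < d / 4 / (`|L| + 1).
  exact: (@cvg_fst _ _ (nbhs p.1) (nbhs p.2) _ _ (small p.1)).
have n2 : \forall q \near p, `|p.2 - q.2| < d / 4 / (`|L| + 1).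
  exact: (@cvg_snd _ _ (nbhs p.1) (nbhs p.2) _ _ (small p.2)).
have key (phi psi : dual X) : `|phi - psi| < d / 4 / (`|L| + 1) ->
    `|u phi - u psi| < d / 4.
  rewrite ltr_pdivlMr// mulrC => h.
  rewrite (le_lt_trans (lu _ _))// (le_lt_trans _ h)// ler_wpM2r//.
  by rewrite (le_trans (ler_norm _))// lerDl.
near=> q.
have q1 : `|p.1 - q.1| < d / 4 / (`|L| + 1) by near: q; exact: n1.
have q2 : `|p.2 - q.2| < d / 4 / (`|L| + 1) by near: q; exact: n2.
have qm : `|midpoint p.1 p.2 - midpoint q.1 q.2| < d / 4 / (`|L| + 1).
  rewrite /midpoint -scalerBr opprD addrACA normrZ ger0_norm//.
  have := ler_normD (p.1 - q.1) (p.2 - q.2); move: q1 q2.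
  move: `|p.1 - q.1| `|p.2 - q.2| `|_ + _| (d / 4 / _) => *; lra.
have dE : d = (u p.1 + u p.2) / 2 - u (midpoint p.1 p.2) by [].
move: dE (key _ _ q1) (key _ _ q2) (key _ _ qm).
rewrite !ltr_norml /strict_at => + /andP[_ +] /andP[_ +] /andP[+ _].
by move: (u p.1) (u p.2) (u q.1) (u q.2) (u _) (u _) => *; lra.
Unshelve. all: by end_near. Qed.

Lemma interpolant_strict_on (C : set (dual X)) (u0 : dual X -> R) :
  E !=set0 -> compact C -> interpolant u0 ->
  (forall phi psi, phi != psi -> exists2 u, interpolant u & strict_at u (phi, psi)) ->
  exists2 v, interpolant v &
    forall phi psi, C phi -> C psi -> phi != psi -> strict_at v (phi, psi).
Proof.
move=> E0 cC iu0 hstrict.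
(* Ordering interpolants by where they are strict gives a filter, along which compactness in
   near-covering form can be applied. *)
pose above u := [set v | interpolant v /\ forall p, strict_at u p -> strict_at v p].
pose F : set_system (dual X -> R) := filter_from interpolant above.
have FF : ProperFilter F.
  apply: filter_from_proper; last by move=> u iu; exists u; split.
  apply: filter_from_filter; first by exists u0.
  (* The mean of [u, v, v, ...] is the average of [u] and [v]. *)
  move=> u v iu iv; pose w n := if n is 0%N then u else v.
  have iw n : interpolant (w n) by case: n.
  have [im sm] := interpolant_dyadic_mean E0 iw.
  exists (fun phi => dyadic_mean (fun n => w n phi)) => // t [it st].
  by split; split=> // p sp; apply: st; [apply: (sm 0%N)|apply: (sm 1%N)].
(* [strict_at] is an open condition, and a mean of two interpolants is strict
   wherever one of them is; so by compactness a single interpolant is strict at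
   all pairs of [C] at distance at least [1 / (n + 1)]. *)
have /choice[u uP] (n : nat) : exists u, interpolant u /\
    forall p, (C `*` C) p -> n.+1%:R^-1 <= `|p.1 - p.2| -> strict_at u p.
  have : \forall u \near F, (C `*` C) `<=`
      (fun p => n.+1%:R^-1 <= `|p.1 - p.2| -> strict_at u p).
    have /compact_near_coveringP := compact_setX cC cC; apply=> p _.
    have [far|clo] := leP n.+1%:R^-1 `|p.1 - p.2|.
      have [|u iu su] := hstrict p.1 p.2.
        apply: contraTneq far => ->; rewrite subrr normr0 -ltNge invr_gt0.
        by rewrite ltr0n.
      have su' : \forall q \near p, strict_at u q.
        by apply: strict_at_open => //; case: p su {far}.
      have Fu : F (above u) by exists u.
      near=> q v => _.
      have [_] : above u v by near: v.
      by apply; near: q.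
    (* Pairs this near to a pair closer than the threshold remain closer than it, so nothing is
       required of them. *)
    pose d := (n.+1%:R^-1 - `|p.1 - p.2|) / 2.
    have d0 : 0 < d by rewrite divr_gt0// subr_gt0.
    have n1 : \forall q \near p, `|p.1 - q.1| < d.
      exact: (@cvg_fst _ _ (nbhs p.1) (nbhs p.2) _ _ (near_dist_lt p.1 d0)).
    have n2 : \forall q \near p, `|p.2 - q.2| < d.
      exact: (@cvg_snd _ _ (nbhs p.1) (nbhs p.2) _ _ (near_dist_lt p.2 d0)).
    near=> q v => qfar; exfalso.
    have q1 : `|p.1 - q.1| < d by near: q.
    have q2 : `|p.2 - q.2| < d by near: q.
    have := ler_distD p.1 q.1 q.2; have := ler_distD p.2 p.1 q.2.
    rewrite (distrC q.1 p.1); move: q1 q2 qfar; rewrite /d.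
    move: n.+1%:R^-1 `|p.1 - p.2| `|p.1 - q.1| `|p.2 - q.2| `|q.1 - q.2| `|p.1 - q.2|.
    move=> *; lra.
  have Fi : F interpolant by exists u0 => // v [].
  by move=> /(filterI Fi)/filter_ex[u [iu su]]; exists u; split.
have [iv sv] := interpolant_dyadic_mean E0 (fun n => (uP n).1).
exists (fun phi => dyadic_mean (fun n => u n phi)) => // phi psi Cphi Cpsi neq.
have d0 : 0 < `|phi - psi| by rewrite normr_gt0 subr_eq0.
(* Then [n + 1] exceeds the inverse of the distance, so [u n] is strict at this pair. *)
pose n := Num.truncn `|phi - psi|^-1.
apply: (sv n); have [_ un] := uP n; apply: un => //=.
rewrite -[leRHS]invrK lef_pV2 ?posrE ?invr_gt0 ?ltr0n//.
by rewrite ltW// truncnS_gt.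
Unshelve. all: by end_near. Qed.
End Interpolants.

(** * Interpolants strict at a given pair *)

Lemma ler_dist_max (R : realDomainType) (a b c d : R) :
  `|Num.max a b - Num.max c d| <= `|a - c| + `|b - d|.
Proof.
have half a1 b1 c1 d1 : Num.max a1 b1 - Num.max c1 d1 <= `|a1 - c1| + `|b1 - d1| :> R.
  have ac := ler_norm (a1 - c1); have bd := ler_norm (b1 - d1).
  have ac0 := normr_ge0 (a1 - c1); have bd0 := normr_ge0 (b1 - d1).
  have c1m : c1 <= Num.max c1 d1 by rewrite le_max lexx.
  have d1m : d1 <= Num.max c1 d1 by rewrite le_max lexx orbT.
  rewrite lerBlDr ge_max; apply/andP; lra.
by rewrite ler_norml half andbT lerNl opprB distrC (distrC b) half.
Qed.

Lemma exists_between (R : realFieldType) (a b c : R) : a < c -> b < c ->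
  exists k, [/\ a <= k, b < k & k < c].
Proof.
move=> ac bc; have mc : Num.max a b < c by rewrite gt_max ac.
exists ((Num.max a b + c) / 2).
have am : a <= Num.max a b by rewrite le_max lexx.
have bm : b <= Num.max a b by rewrite le_max lexx orbT.
by split; lra.
Qed.

Lemma dual_shift (R : realType) (X : normedModType R) (phi : dual X) (z x : X)
    (c e k : R) :
  phi (z + e *: x) - (c + e * k) = phi z - c + e * (phi x - k).
Proof. by rewrite dual_funD dual_funZ; ring. Qed.

Section Interpolation.
Context (R : realType) (X : normedModType R) (E : set X) (f : X -> R).
Context (G : X -> dual X) (L M : R).
Hypothesis E0 : E !=set0.
Hypothesis cE : compact E.
Hypothesis cG : {within E, continuous G}.
Hypothesis EL1 : forall z, E z -> `|z| + 1 <= L.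
Hypothesis GM : forall z, E z -> `|G z| <= M.
Hypothesis condC : forall y z, E y -> E z -> f z + G z (y - z) <= f y.

Let EL z : E z -> `|z| <= L. Proof. by move=> /EL1; apply: le_trans; rewrite lerDl. Qed.
Let M0 : 0 <= M. Proof. by have [z Ez] := E0; rewrite (le_trans _ (GM Ez)). Qed.
Let L0 : 0 <= L. Proof. by have [z Ez] := E0; rewrite (le_trans _ (EL Ez)). Qed.

(** (C) bounds [f a - f b] by [G a (a - b)]; exchanging the points gives the other side. *)
Lemma data_lipschitz y z : E y -> E z -> `|f y - f z| <= M * `|y - z|.
Proof.
have half a b : E a -> E b -> f a - f b <= M * `|a - b|.
  move=> Ea Eb; have := condC Eb Ea.
  have : `|G a (b - a)| <= M * `|a - b|.
    by rewrite (le_trans (ler_dual _ _))// distrC ler_wpM2r// GM.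
  by rewrite ler_norml => /andP[]; lra.
by move=> Ey Ez; rewrite ler_norml half// andbT lerNl opprB distrC half.
Qed.

(** [g] is the conjugate of [f] on [E]; (C) says exactly that [z] attains the maximum at [G z].
    Attainment later provides a contact point at a midpoint. *)
Lemma max_interpolant : exists2 g, interpolant E f G L g &
  forall phi, exists2 z, E z & g phi = phi z - f z.
Proof.
have /choice[zeta zetaP] (phi : dual X) : exists z, E z /\
    forall y, E y -> phi y - f y <= phi z - f z.
  have [|z] := compact_EVT_max E0 cE (f := fun z => phi z - f z).
    apply: (within_continuous_dominated (G := G) (a := 0) (b := `|phi| + M)) => // y z Ey Ez.
    rewrite mul0r add0r mulrDl.
    rewrite (_ : _ - _ = phi (y - z) - (f y - f z)); last by rewrite dual_funB; lra.
    by rewrite (le_trans (ler_normB _ _))// lerD ?ler_dual ?data_lipschitz.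
  rewrite inE => Ez h; exists z; split=> // y Ey; apply: h; exact: mem_set.
pose g (phi : dual X) := phi (zeta phi) - f (zeta phi).
have gge (phi : dual X) z : E z -> phi z - f z <= g phi by apply: (zetaP phi).2.
exists g; last by move=> phi; exists (zeta phi) => //; exact: (zetaP phi).1.
split=> //.
- move=> phi psi; have Ez := (zetaP (midpoint phi psi)).1.
  rewrite {1}/g midpointE; have := gge phi _ Ez; have := gge psi _ Ez; lra.
- have half phi psi : g phi - g psi <= L * `|phi - psi|.
    have Ez := (zetaP phi).1; have := gge psi _ Ez; rewrite {2}/g.
    have : `|(phi - psi) (zeta phi)| <= L * `|phi - psi|.
      by rewrite (le_trans (ler_dual _ _))// mulrC ler_wpM2r// EL.
    by rewrite dualB ler_norml => /andP[_]; lra.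
  by move=> phi psi; rewrite ler_norml half// andbT lerNl opprB distrC half.
- move=> z Ez; apply/eqP; rewrite eq_le gge// andbT.
  have := condC (zetaP (G z)).1 Ez; rewrite dual_funB /g; lra.
Qed.

Hypothesis condCW1 :
  forall y z, E y -> E z -> f y = f z + G z (y - z) -> G y = G z.

(* (CW^1) forces every tangent plane almost touching [f] at [z] to have nearly
   the slope [G z]; quantitatively, moving the point [z] to [z + e x] raises the
   maximum of the tangent planes by at most [e kappa]. *)
Lemma tangent_planes_slope (z x : X) (kappa : R) : E z -> G z x < kappa ->
  exists e, [/\ 0 < e, e <= 1 &
    forall y, E y -> e * (G y x - kappa) <= f z - f y - G y (z - y)].
Proof.
move=> Ez zk; pose D y := f z - f y - G y (z - y).
have D0 y : E y -> 0 <= D y by move=> Ey; have := condC Ez Ey; rewrite /D; lra.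
(* [h] is positive on [E]: where [D y] vanishes, (CW^1) gives [G y = G z], so the second term is
   positive. Compactness yields a positive minimum. *)
pose h y := Num.max (D y) (kappa - G y x).
have GB y y' v : `|G y v - G y' v| <= `|v| * `|G y - G y'|.
  by rewrite -dualB mulrC ler_dual.
have [|y0] := compact_EVT_min E0 cE (f := h).
  apply: (within_continuous_dominated (G := G) (a := 2 * L + `|x|) (b := 2 * M)) => //.
  move=> y y' Ey Ey'; rewrite (le_trans (ler_dist_max _ _ _ _))//.
  have hx : `|kappa - G y x - (kappa - G y' x)| <= `|x| * `|G y - G y'|.
    by rewrite (_ : _ - _ = - (G y x - G y' x)) ?normrN//; lra.
  have hD : `|D y - D y'| <= 2 * L * `|G y - G y'| + 2 * M * `|y - y'|.
    have -> : D y - D y' = - (f y - f y') - (G y (z - y) - G y' (z - y)) + G y' (y - y').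
      rewrite /D !dual_funB; lra.
    have h1 := data_lipschitz Ey Ey'.
    have h2 : `|G y (z - y) - G y' (z - y)| <= 2 * L * `|G y - G y'|.
      rewrite (le_trans (GB _ _ _))// ler_wpM2r// (le_trans (ler_normB _ _))//.
      by have := EL Ez; have := EL Ey; lra.
    have h3 : `|G y' (y - y')| <= M * `|y - y'|.
      by rewrite (le_trans (ler_dual _ _))// ler_wpM2r// GM.
    have h4 := ler_normD (- (f y - f y') - (G y (z - y) - G y' (z - y))) (G y' (y - y')).
    have h5 := ler_normB (- (f y - f y')) (G y (z - y) - G y' (z - y)).
    rewrite normrN in h5.
    rewrite (le_trans h4)//; move: h1 h2 h3 h5.
    move: `|f y - f y'| `|_ - _ : R| `|_ : R| `|G y (z - y) - _| `|G y' _| => *; lra.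
  by move: hx hD; lra.
rewrite inE => Ey0 hmin.
have h0 : 0 < h y0.
  rewrite lt_max; have [//|Dy0 /=] := ltP 0 (D y0).
  have Dy00 : D y0 = 0 by apply/eqP; rewrite eq_le Dy0 D0.
  rewrite -(condCW1 Ez Ey0) ?subr_gt0//.
  by move: Dy00; rewrite /D; lra.
set d := h y0 in h0 hmin.
have B0 : 0 < M * `|x| + `|kappa| + 1 by rewrite ltr_wpDl ?addr_ge0 ?mulr_ge0.
(* If [D y >= d], this [e] keeps the left side below [d]; otherwise [G y x < kappa] and the left
   side is negative. *)
exists (Num.min 1 (d / (M * `|x| + `|kappa| + 1))); set e := Num.min _ _.
have e0 : 0 < e by rewrite lt_min ltr01 divr_gt0.
split=> //; first by rewrite ge_min lexx.
move=> y Ey; have := hmin y (mem_set Ey); rewrite le_max => /orP[dD|dk].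
  apply: le_trans dD; apply: (@le_trans _ _ (e * (M * `|x| + `|kappa| + 1))).
    rewrite ler_wpM2l ?(ltW e0)//.
    have : `|G y x| <= M * `|x|.
      by rewrite (le_trans (ler_dual _ _))// ler_wpM2r// GM.
    rewrite ler_norml => /andP[_]; have := ler_norm (- kappa); rewrite normrN; lra.
  by rewrite -ler_pdivlMr// ge_min lexx orbT.
apply: le_trans (D0 y Ey); rewrite pmulr_rle0//.
by move: h0 dk; lra.
Qed.

(** At [chi] the added function is [chi z - f z + e (chi x - kappa)]. It leaves the midpoint value
    unchanged but raises the value at [psi] strictly above [psi z - f z], so the maximum bends
    inside the segment. *)
Lemma strict_interpolant_half (g : dual X -> R) (phi psi : dual X) (z x : X) :
  interpolant E f G L g -> E z -> g (midpoint phi psi) = midpoint phi psi z - f z ->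
  `|x| <= 1 -> phi x < psi x -> G z x < psi x ->
  exists2 u, interpolant E f G L u & strict_at u (phi, psi).
Proof.
move=> ig Ez gm x1 ltx Gx.
(* [kappa] must exceed [G z x] for the slope lemma, be at least the midpoint value so as not to
   raise it, and stay below [psi x]. *)
have [|kappa [mk Gk kpsi]] := exists_between (a := midpoint phi psi x) _ Gx.
  by rewrite midpointE ltr_pdivrMr// mulr_natr mulr2n ltrD2r.
have [e [e0 e1 he]] := tangent_planes_slope Ez Gk.
have [_ _ gge _] := ig.
exists (fun chi : dual X => Num.max (g chi) (chi (z + e *: x) - (f z + e * kappa))).
  apply: interpolant_max => //.
    (* The unit margin in [EL1] absorbs the shift [e *: x]. *)
    rewrite (le_trans (ler_normD _ _))// (le_trans _ (EL1 Ez))// lerD2l.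
    by rewrite normrZ gtr0_norm// mulr_ile1// ltW.
  move=> y Ey; rewrite dual_shift -lerBrDl; apply: le_trans (he y Ey) _.
  by rewrite dual_funB le_eqVlt; apply/orP; left; apply/eqP; ring.
have em : e * (midpoint phi psi x - kappa) <= 0 by rewrite pmulr_rle0// subr_le0.
have ep : 0 < e * (psi x - kappa) by rewrite mulr_gt0// subr_gt0.
have um : Num.max (g (midpoint phi psi))
    (midpoint phi psi (z + e *: x) - (f z + e * kappa)) = midpoint phi psi z - f z.
  by rewrite gm dual_shift; apply/max_idPl; rewrite gerDl.
have h1 : phi z - f z <= Num.max (g phi) (phi (z + e *: x) - (f z + e * kappa)).
  by rewrite le_max gge.
have h2 : psi z - f z + e * (psi x - kappa) <=
    Num.max (g psi) (psi (z + e *: x) - (f z + e * kappa)).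
  by rewrite le_max dual_shift lexx orbT.
rewrite /strict_at um midpointE ltr_pdivlMr//; apply: lt_le_trans (lerD h1 h2).
rewrite [ltLHS](_ : _ = phi z - f z + (psi z - f z)); last by field.
by rewrite [ltRHS]addrA ltrDl.
Qed.

Lemma strict_interpolant (phi psi : dual X) : phi != psi ->
  exists2 u, interpolant E f G L u & strict_at u (phi, psi).
Proof.
move=> neq; have [g ig gat] := max_interpolant.
have [z Ez gm] := gat (midpoint phi psi).
have [x x1 xneq] : exists2 x : X, `|x| <= 1 & phi x < psi x.
  have [|x x1] := @dual_norming _ _ (psi - phi) 0.
    by rewrite normr_gt0 subr_eq0 eq_sym.
  rewrite dualB normr_gt0 subr_eq0 neq_lt => /orP[lt|]; last by exists x.
  by exists (- x); rewrite ?normrN// !dual_funN ltrN2.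
have [Gx|Gx] := ltP (G z x) (psi x).
  exact: (strict_interpolant_half ig Ez gm x1 xneq Gx).
(* Here [phi x < psi x <= G z x], so exchanging [phi] with [psi] and [x] with [- x] restores the
   hypotheses. *)
have mC : midpoint psi phi = midpoint phi psi by rewrite /midpoint addrC.
have [||||u iu su] := @strict_interpolant_half g psi phi z (- x) ig Ez.
- by rewrite mC.
- by rewrite normrN.
- by rewrite !dual_funN ltrN2.
- by rewrite !dual_funN ltrN2 (lt_le_trans xneq).
by exists u => //; move: su; rewrite /strict_at -/(midpoint _ _) mC [u psi + _]addrC.
Qed.
End Interpolation.

(** * Subgradients, Lipschitz constants and the interpolation theorem *)

(** A single step replaces passing to a limit; [t <= 1] lets it serve as a convex weight. *)
Lemma diff_directional (R : realType) (X : normedModType R) (F : X -> R^o)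
    (x v : X) (e : R) : differentiable F x -> 0 < e ->
  exists t, [/\ 0 < t, t <= 1 &
    `|F (t *: v + x) - F x - t * DF F x v| <= t * e].
Proof.
move=> dF e0; have /eqaddoP/(_ (e / (`|v| + 1))) := diff_locally dF.
have v1 : 0 < `|v| + 1 by rewrite ltr_wpDl.
rewrite divr_gt0// => /(_ isT)/nbhs_ballP[d /= d0 dP].
pose t := Num.min 1 (d / 2 / (`|v| + 1)).
have t0 : 0 < t by rewrite lt_min ltr01 !divr_gt0.
exists t; split=> //; first by rewrite ge_min lexx.
have tv : t * `|v| <= t * (`|v| + 1) by rewrite ler_wpM2l ?(ltW t0)// lerDl.
have /dP : ball 0 d (t *: v).
  rewrite -ball_normE /= sub0r normrN normrZ gtr0_norm// (le_lt_trans tv)//.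
  rewrite (@le_lt_trans _ _ (d / 2))//; last by rewrite gtr_pMr// invf_lt1// ltr1n.
  by rewrite -ler_pdivlMr// ge_min lexx orbT.
rewrite /= normrZ gtr0_norm// => h; rewrite -dual_funZ DFE//.
rewrite (_ : _ - _ - _ = F (t *: v + x) - (F x + 'd F x (t *: v))) ?opprD ?addrA//.
move: h; rewrite opprD addrA => h; apply: le_trans h _.
rewrite mulrCA ler_wpM2l ?(ltW t0)//.
by rewrite -mulrA ler_piMr ?(ltW e0)// mulrC ler_pdivrMr// mul1r lerDl.
Qed.

(** Dividing the subgradient inequality along [t *: v] by [t] gives [phi v <= DF F x v]; [- v] gives
    the converse. *)
Lemma diff_subgradient_unique (R : realType) (X : normedModType R) (F : X -> R^o)
    (x : X) (phi : dual X) : differentiable F x ->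
  (forall y, F x + phi (y - x) <= F y) -> DF F x = phi.
Proof.
move=> dF sub.
have half v : phi v <= DF F x v.
  apply/ler_addgt0Pr => e e0; have [t [t0 _ ht]] := diff_directional v dF e0.
  have := sub (t *: v + x); rewrite addrK dual_funZ => hsub.
  rewrite -(ler_pM2l t0) mulrDr.
  by move: ht; rewrite ler_norml => /andP[_]; move: hsub; lra.
apply: dual_ext => v; apply/eqP; rewrite eq_le half andbT.
by have := half (- v); rewrite !dual_funN lerN2.
Qed.

Lemma convex_diff_subgradient (R : realType) (X : normedModType R) (F : X -> R^o)
    (x y : X) : convex_function (setT : set (convex_lmodType X)) F ->
  differentiable F x -> F x + DF F x (y - x) <= F y.
Proof.
move=> cF dF; apply/ler_addgt0Pr => e e0.
have [t [t0 t1 ht]] := diff_directional (y - x) dF e0.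
have hconv : F (t *: y + (1 - t) *: x) <= t * F y + (1 - t) * F x.
  by apply: (cF (Itv01 (ltW t0) t1) y x); rewrite inE.
rewrite (_ : t *: y + (1 - t) *: x = t *: (y - x) + x) in hconv; last first.
  by rewrite scalerBr scalerBl scale1r -addrA [x - _]addrC.
rewrite -(ler_pM2l t0) !mulrDr.
by move: ht; rewrite ler_norml => /andP[+ _]; move: hconv; lra.
Qed.

Lemma Lip_le (R : realType) (X : normedModType R) (F : X -> R^o) (M : R) :
  0 <= M -> (forall x y, `|F x - F y| <= M * `|x - y|) -> (Lip F <= M%:E)%E.
Proof.
move=> M0 FM; apply: ge_ereal_sup => _ [->|[[x y] /= xy <-]]; rewrite lee_fin//.
by rewrite ler_pdivrMr// normr_gt0 subr_eq0.
Qed.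

(** If [Lip F] were a smaller real [c], a short step along a vector where the derivative exceeds [c]
    would have too large a difference quotient. *)
Lemma norm_DF_le_Lip (R : realType) (X : normedModType R) (F : X -> R^o) (x : X) :
  differentiable F x -> (`|DF F x|%:E <= Lip F)%E.
Proof.
move=> dF; have Lip0 : (0 <= Lip F)%E by apply: ereal_sup_ubound; left.
rewrite leNgt; apply/negP => LipM.
have Lipfin : Lip F \is a fin_num by rewrite ge0_fin_numE// (lt_le_trans LipM)// leey.
have [c LipE] : exists c, Lip F = c%:E by exists (fine (Lip F)); rewrite fineK.
move: Lip0 LipM; rewrite LipE lee_fin lte_fin => c0 /dual_norming[v v1 cv].
have v0 : v != 0 by apply: contraTneq cv => ->; rewrite dual_fun0 normr0 -leNgt.
pose e := (`|DF F x v| - c) / 2.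
have e0 : 0 < e by rewrite divr_gt0// subr_gt0.
have [t [t0 _ ht]] := diff_directional v dF e0.
have neq : t *: v + x != x by rewrite -subr_eq0 addrK scaler_eq0 negb_or gt_eqF.
have : ((`|F (t *: v + x) - F x| / `|t *: v + x - x|)%:E <= Lip F)%E.
  by apply: ereal_sup_ubound; right; exists (t *: v + x, x).
rewrite LipE lee_fin addrK leNgt => /negP; apply.
rewrite ltr_pdivlMr; last by rewrite normr_gt0 scaler_eq0 negb_or gt_eqF.
rewrite normrZ gtr0_norm//.
apply: (@le_lt_trans _ _ (t * c)); first by rewrite mulrCA ler_wpM2l ?(ltW t0)// ler_piMr.
apply: (@lt_le_trans _ _ (t * `|DF F x v| - t * e)).
  by rewrite -mulrBr ltr_pM2l// /e; lra.
rewrite -{1}(gtr0_norm t0) -normrM lerBlDr.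
rewrite -(subrK (F (t *: v + x) - F x) (t * DF F x v)) (le_trans (ler_normD _ _))//.
by rewrite addrC lerD2l distrC.
Qed.

Lemma convex_C1_interpolation (R : realType) (X : normedModType R) (E : set X)
    (f : X -> R) (G : X -> dual X) (M : R) :
  E !=set0 -> compact E -> {within E, continuous G} ->
  (forall z, E z -> `|G z| <= M) ->
  (forall y z, E y -> E z -> f z + G z (y - z) <= f y) ->
  (forall y z, E y -> E z -> f y = f z + G z (y - z) -> G y = G z) ->
  exists F : X -> R,
    [/\ convex_function (setT : set (convex_lmodType X)) F, C1 F,
      forall z, E z -> F z = f z /\ DF F z = G z,
      forall x y, `|F x - F y| <= M * `|x - y| & forall x, `|DF F x| <= M].
Proof.
move=> E0 cE cG GM condC condCW1.
have M0 : 0 <= M by have [z Ez] := E0; rewrite (le_trans _ (GM _ Ez)).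
have [L' _ EL'] := compact_norm_bound cE; pose L := L' + 1.
have EL z : E z -> `|z| + 1 <= L by move=> /EL'; rewrite lerD2r.
pose K := G @` E; pose C := below_support K.
have cC : compact C by apply/compact_below_support/continuous_compact.
have CM phi : C phi -> `|phi| <= M.
  by apply: norm_below_support_le => // _ [z Ez <-]; exact: GM.
have CG z : E z -> C (G z) by move=> Ez x m; apply; exists z.
have Cmid phi psi : C phi -> C psi -> C (midpoint phi psi).
  move=> Cphi Cpsi x m hm; rewrite midpointE ler_pdivrMr// mulr_natr mulr2n.
  by rewrite lerD ?Cphi ?Cpsi.
have [g ig _] := max_interpolant E0 cE cG EL GM condC.
have [v iv strict] := interpolant_strict_on E0 cC ig
  (strict_interpolant E0 cE cG EL GM condC condCW1).
have [_ lv gv ev] := iv.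
(* At the midpoint of two distinct maximizers strictness would give a larger value. *)
have uniq x phi psi : C phi -> C psi ->
    (forall chi, C chi -> chi x - v chi <= phi x - v phi) ->
    (forall chi, C chi -> chi x - v chi <= psi x - v psi) -> phi = psi.
  move=> Cphi Cpsi hphi hpsi; apply: contrapT => /eqP neq.
  have := strict _ _ Cphi Cpsi neq; have := Cmid _ _ Cphi Cpsi.
  move=> Cm; have := hphi _ Cm; have := hpsi _ Cm.
  rewrite midpointE /strict_at/=; lra.
have C0 : C !=set0 by have [z Ez] := E0; exists (G z); exact: CG.
have cv : continuous v := @lip_continuous _ (dual X) R^o _ _ lv.
have [F [convF C1F lipF Fmax]] := conjugate_C1 cC C0 cv CM uniq.
exists F; split=> // [z Ez|x]; last by have [/CM] := Fmax x.
have [CF FE Fge] := Fmax z.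
have Fz : F z = f z.
  apply/eqP; rewrite eq_le; apply/andP; split.
    by rewrite FE; have := gv (DF F z) z Ez; lra.
  by have := Fge _ (CG z Ez); rewrite ev//; lra.
(* Since [F z = f z], [G z] also attains the maximum at [z]. *)
split=> //; apply: (uniq z) => //; first exact: CG.
  by rewrite -FE.
by move=> chi Cchi; rewrite ev// subKr -Fz; exact: Fge.
Qed.

Theorem theorem1p6 (R : realType) (X : completeNormedModType R)
  (hX : superreflexive X) (E : set X) (hE0 : E !=set0) (hE : compact E)
  (f : X -> R) (G : X -> dual X) (hG : {within E, continuous G}) :
  let condC := forall y z, E y -> E z -> f z + G z (y - z) <= f y in
  let condCW1 := forall y z, E y -> E z -> f y = f z + G z (y - z) -> G y = G z in
  let convex_extension (F : X -> R) :=
    [/\ convex_function (setT : set (convex_lmodType X)) F, C1 F,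
        forall z, E z -> F z = f z & forall z, E z -> DF F z = G z] in
  ((exists F : X -> R, convex_extension F) <-> (condC /\ condCW1)) /\
  (condC /\ condCW1 ->
    exists F : X -> R,
      [/\ convex_extension F, [lipschitz F x | x in setT],
          Lip F = ereal_sup [set `|DF F x|%:E | x in [set: X]] &
          Lip F = ereal_sup [set `|G z|%:E | z in E]]).
Proof.
move=> condC condCW1 convex_extension.
have sufficiency : condC /\ condCW1 -> exists F : X -> R,
    [/\ convex_extension F, [lipschitz F x | x in setT],
        Lip F = ereal_sup [set `|DF F x|%:E | x in [set: X]] &
        Lip F = ereal_sup [set `|G z|%:E | z in E]].
  move=> [hC hCW1].
  (* The norm of [G] peaks at [z1]. It bounds every slope of [F] and is attained by [DF F z1], so
     all the suprema equal it. *)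
  have [z1 Ez1 z1max] : exists2 z1, E z1 & forall z, E z -> `|G z| <= `|G z1|.
    have [|z1] := compact_EVT_max hE0 hE (f := fun z => `|G z|).
      apply: (within_continuous_dominated (a := 1) (b := 0) hG) => y z _ _.
      by rewrite mul1r mul0r addr0 ler_dist_dist.
    by rewrite inE => Ez1 h; exists z1 => // z Ez; apply: h; rewrite inE.
  have [F [convF C1F FE lipF DFM]] := convex_C1_interpolation hE0 hE hG z1max hC hCW1.
  have LipE : Lip F = `|G z1|%:E.
    apply/eqP; rewrite eq_le Lip_le//= -(FE _ Ez1).2 norm_DF_le_Lip//.
    by have [dF _] := C1F.
  have supE (A : set \bar R) : A `|G z1|%:E -> (forall a, A a -> (a <= `|G z1|%:E)%E) ->
      Lip F = ereal_sup A.
    move=> Ain Aub; apply/eqP; rewrite LipE eq_le ereal_sup_ubound//=.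
    exact: ge_ereal_sup.
  exists F; split.
  - by split=> // z /FE[].
  - apply: filterS (nbhs_pinfty_ge (num_real `|G z1|)) => K MK -[x y] _ /=.
    by apply: (le_trans (lipF x y)); rewrite ler_wpM2r.
  - apply: supE; first by exists z1 => //; rewrite (FE _ Ez1).2.
    by move=> _ [x _ <-]; rewrite lee_fin.
  - by apply: supE; [exists z1|move=> _ [z Ez <-]; rewrite lee_fin z1max].
split=> //; split; last by move=> /sufficiency[F [? _ _ _]]; exists F.
move=> [F [convF [dF _] Ff FG]].
have sub x y := convex_diff_subgradient y convF (dF x).
split=> [y z Ey Ez|y z Ey Ez eqf].
  by have := sub z y; rewrite !Ff// FG.
(* Equality in (C) makes the tangent plane at [z] touch [F] at [y], so [G z] is a subgradient there
   as well. *)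
rewrite -FG//; apply: diff_subgradient_unique => // x.
by have := sub z x; rewrite FG// (Ff z)// (Ff y)// eqf !dual_funB; lra.
Qed.
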